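(* Let $d\ge 1$ and $n>2d$ be integers and let $\Delta$ be a traceable $d$-dimensional simplicial complex on $n$ vertices. (1) Suppose that there is a labeling of the vertices of $\Delta$ by $1,\dots,n$ that makes $\Delta$ traceable and for which the two sets $\sigma=\{1,\dots,d\}$ (first $d$ vertices) and $\tau=\{n-d+1,\dots,n\}$ (last $d$ vertices) satisfy $d_\sigma+d_\tau\ge n$. Then $\Delta$ is weakly-Hamiltonian. (2) In particular, if $\Delta$ is moreover pure and every $(d-1)$-face of $\Delta$ belongs to at least $\frac n2$ facets of $\Delta$, then $\Delta$ is weakly-Hamiltonian.
   Context: A labeling of a simplicial complex with $n$ vertices is a bijection of its vertex set with $\{1,\dots,n\}$. Given a labeling, for $i\in\{1,\dots,n\}$ let $H_i$ be the $(d+1)$-element set $\{i,i+1,\dots,i+d\}$, where labels are read modulo $n$ (so $n+1$ means $1$, etc.); for $i\le n-d$ no reduction is needed. A labeling makes $\Delta$ traceable if $H_1,\dots,H_{n-d}$ are all faces of $\Delta$; $\Delta$ is traceable if some labeling makes it traceable. $\Delta$ is weakly-Hamiltonian if it has a labeling for which there are indices $1\le i_1<\dots<i_k\le n$ such that $H_{i_1},\dots,H_{i_k}$ are faces of $\Delta$, together they cover all vertices, $H_{i_j}\cap H_{i_{j+1}}\neq\emptyset$ for each $j\in\{1,\dots,k-1\}$, and $H_{i_k}\cap H_{i_1}\ne\emptyset$. For a $(d-1)$-face $\rho$ of $\Delta$, its degree $d_\rho$ is the number of $d$-faces of $\Delta$ containing $\rho$. *)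

(* Defs.v *)
From mathcomp Require Import all_boot.

Set Implicit Arguments.
Unset Strict Implicit.
Unset Printing Implicit Defensive.

(* A finite abstract simplicial complex whose vertex set is the whole type V. *)
Record complex (V : finType) := Complex {
  faces :> {set {set V}};
  face_sub : forall F G : {set V}, F \in faces -> G \subset F -> G \in faces;
  face_vertex : forall v : V, [set v] \in faces
}.

Section Complexes.

Variables (V : finType) (K : complex V).

(* A k-dimensional face, or k-face, is a face with k + 1 elements. *)
Definition has_dim (d : nat) : Prop := \max_(F in faces K) #|F| = d.+1.

Definition facets : {set {set V}} :=
  [set F | maxset (fun G : {set V} => G \in faces K) F].

Definition pure : Prop :=
  forall F G : {set V}, F \in facets -> G \in facets -> #|F| = #|G|.

(* The number of d-faces containing rho; used for (d-1)-faces rho. *)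
Definition degree (d : nat) (rho : {set V}) : nat :=
  #|[set F in faces K | (#|F| == d.+1) && (rho \subset F)]|.

Section Labelings.

(* Labels are shifted to start at 0: a labeling is a bijection l : V -> 'I_n, *)
(* and the vertex usually labeled i + 1 is the one with l v = i. Below, d is  *)
(* meant to be the dimension of K.                                            *)
Variables (n d : nat).

Definition window (l : V -> 'I_n) (i : nat) : {set V} :=
  [set v | [exists j : 'I_d.+1, val (l v) == (i + j) %% n]].

Definition makes_traceable (l : V -> 'I_n) : Prop :=
  forall i : nat, i < n - d -> window l i \in faces K.

Definition traceable : Prop :=
  exists2 l : V -> 'I_n, bijective l & makes_traceable l.

(* [cycle] requires consecutive windows of s to meet, as well as the last one *)
(* and the first one; s is nonempty as soon as V is, by the covering clause.  *)
Definition weakly_hamiltonian : Prop :=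
  exists2 l : V -> 'I_n, bijective l &
    exists s : seq 'I_n,
      [/\ sorted (fun i j : 'I_n => i < j) s,
          forall i, i \in s -> window l i \in faces K,
          forall v, exists2 i, i \in s & v \in window l i
        & cycle (fun i j : 'I_n => window l i :&: window l j != set0) s].

Definition first_vertices (l : V -> 'I_n) : {set V} := [set v | l v < d].

Definition last_vertices (l : V -> 'I_n) : {set V} := [set v | n - d <= l v].

End Labelings.

End Complexes.

(* Main.v *)
(** Ore's rotation argument: by pigeonhole there is a label [i] such that
[sigma] together with the vertex labeled [i + 1] and [tau] together with the
vertex labeled [i] are both faces. Listing the vertices in the order
[0, .., i, n - 1, n - 2, .., i + 1] turns these two faces into windows, which
join the windows inside the two runs of the old labeling into a cycle. *)

Require Import Defs.
From mathcomp Require Import all_boot zify.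

Set Implicit Arguments.
Unset Strict Implicit.
Unset Printing Implicit Defensive.

(** * Windows as intervals of labels *)

Section Windows.

Variables (V : finType) (n d : nat) (l : V -> 'I_n).

Lemma in_window (k : nat) (v : V) :
  k + d < n -> (v \in window d l k) = (k <= l v <= k + d).
Proof.
move=> kdn; rewrite inE; apply/existsP/andP => [[j /eqP /= ->]|[lekv levk]].
  have ltj := ltn_ord j.
  rewrite modn_small; lia.
have ltj : l v - k < d.+1 by lia.
exists (Ordinal ltj) => /=.
rewrite subnKC // modn_small //.
Qed.

(** The one window used below that wraps around modulo [n]; it will close the cycle. *)
Lemma in_last_window (v : V) :
  d < n -> (v \in window d l n.-1) = (l v < d) || (l v == n.-1 :> nat).
Proof.
move=> dn; rewrite inE; apply/existsP/orP => [[j /eqP /= ->]|].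
  have ltj := ltn_ord j.
  case: (posnP j) => [->|j_gt0]; first by right; rewrite addn0 modn_small //; lia.
  left; have -> : n.-1 + j = j.-1 + n by lia.
  rewrite modnDr modn_small; lia.
case=> [lvd|/eqP lvn].
  exists (Ordinal (lvd : (l v).+1 < d.+1)) => /=.
  have -> : n.-1 + (l v).+1 = l v + n by lia.
  by rewrite modnDr modn_small.
exists ord0 => /=; rewrite addn0 modn_small ?lvn //; lia.
Qed.

(** The vertex labeled [j] starts the window at [j], so it is a common vertex once [j] is among the
    labels of the window at [i]. *)
Lemma window_meet (i j : 'I_n) :
  bijective l -> [exists t : 'I_d.+1, val j == (i + t) %% n] ->
  window d l i :&: window d l j != set0.
Proof.
case=> g _ gK ij; apply/set0Pn; exists (g j).
rewrite !inE gK ij /=; apply/existsP; exists ord0.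
by rewrite addn0 modn_small.
Qed.

End Windows.

(** * Degrees and the pigeonhole argument *)

(** A [d]-face containing [rho] exceeds it by a single vertex, so it is a value of [v |: rho]. *)
Lemma degree_le_link (V : finType) (K : complex V) (d : nat) (rho : {set V}) :
  #|rho| = d ->
  degree K d rho <= #|[set v | (v \notin rho) && (v |: rho \in faces K)]|.
Proof.
move=> cardrho.
apply: (leq_trans _ (leq_imset_card (fun v => v |: rho) _)).
apply/subset_leq_card/subsetP => F; rewrite inE => /and3P[FK /eqP cardF rhoF].
have /cards1P[v Fv] : #|F :\: rho| == 1.
  by rewrite cardsDS // cardF cardrho subSn // subnn.
have vFrho : v |: rho = F by rewrite -Fv setUC -[RHS](setID F rho) (setIidPr rhoF).
apply/imsetP; exists v => //; rewrite inE vFrho FK andbT.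
by have := set11 v; rewrite -Fv inE => /andP[].
Qed.

Lemma card_label_pred (V : finType) (n : nat) (l : V -> 'I_n) (P : pred 'I_n) :
  bijective l -> #|[set v | P (l v)]| = #|[set i | P i]|.
Proof.
move=> bl; rewrite -(on_card_preimset (onW_bij _ bl)).
by apply: eq_card => v; rewrite !inE.
Qed.

Lemma card_ord_lt (n d : nat) : d <= n -> #|[set i : 'I_n | i < d]| = d.
Proof.
move=> dn; rewrite -[RHS](card_ord d).
rewrite -(card_imset 'I_d (f := widen_ord dn)); last first.
  by move=> i j /(congr1 val) /= /val_inj.
apply: eq_card => i; rewrite inE; apply/idP/imsetP => [id|[j _ ->]] /=.
  by exists (Ordinal id) => //; apply: val_inj.
by [].
Qed.

Section Ends.

Variables (V : finType) (n d : nat) (l : V -> 'I_n).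
Hypotheses (dn : d <= n) (l_bij : bijective l).

Lemma card_first_vertices : #|first_vertices d l| = d.
Proof. by rewrite (card_label_pred (fun i => i < d)) // card_ord_lt. Qed.

Lemma card_last_vertices : #|last_vertices d l| = d.
Proof.
rewrite (card_label_pred (fun i => n - d <= i)) //.
have := cardsC [set i : 'I_n | i < n - d].
rewrite card_ord_lt ?leq_subr // card_ord.
have -> : ~: [set i : 'I_n | i < n - d] = [set i : 'I_n | n - d <= i].
  by apply/setP => i; rewrite !inE -leqNgt.
by move=> /(canRL (addKn _)) ->; rewrite subKn.
Qed.

End Ends.

Lemma rotation_index (V : finType) (n d : nat) (K : complex V) (l : V -> 'I_n) :
  1 <= d -> d <= n -> bijective l ->
  n <= degree K d (first_vertices d l) + degree K d (last_vertices d l) ->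
  exists v w : V, [/\ val (l w) = (l v).+1, d <= l w, l v < n - d,
    w |: first_vertices d l \in faces K & v |: last_vertices d l \in faces K].
Proof.
move=> d_gt0 dn l_bij le_n.
have := degree_le_link K (card_first_vertices dn l_bij).
have := degree_le_link K (card_last_vertices dn l_bij).
set T := [set v | _]; set S := [set v | _] => leT leS.
have n_gt0 : 0 < n by lia.
(* [A] and [B] both miss label 0: vertices outside [sigma] have label at least [d], and the
   successor of a label below [n - d] does not wrap. Two subsets of [n - 1] labels with sizes adding
   up to at least [n] must meet. *)
pose A := l @: S; pose B := (fun v => ordS (l v)) @: T.
have cA : #|A| = #|S| by rewrite card_imset //; apply: bij_inj.
have cB : #|B| = #|T|.
  by rewrite card_imset // => x y /(can_inj (@ordSK _)); apply: (bij_inj l_bij).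
have sAB : A :|: B \subset [set~ Ordinal n_gt0].
  apply/subsetP => j; rewrite !inE -val_eqE /= => /orP[] /imsetP[v].
    rewrite !inE -leqNgt => /andP[dv _] ->; lia.
  rewrite !inE -ltnNge => /andP[dv _] -> /=.
  rewrite modn_small; lia.
have := subset_leq_card sAB; rewrite cardsC1 card_ord => cAB.
have : 0 < #|A :&: B| by have := cardsUI A B; lia.
case/card_gt0P => j; rewrite inE => /andP[/imsetP[w Sw ->] /imsetP[v Tv lw]].
move: Sw Tv; rewrite !inE -leqNgt -ltnNge => /andP[dw wK] /andP[vd vK].
exists v, w; split => //.
rewrite lw /= modn_small //; lia.
Qed.

(** * Reversing the labels above [i] *)

Section Rotation.

Variables (n i : nat).

(** On labels below [n] this is an involution, so it translates old labels to new ones and back. *)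
Definition rotate (x : nat) : nat := if x <= i then x else n + i - x.

Lemma rotate_lt (x : nat) : i < n -> x < n -> rotate x < n.
Proof. by rewrite /rotate; case: (leqP x i); lia. Qed.

Lemma rotateK (x : nat) : x < n -> rotate (rotate x) = x.
Proof. by rewrite /rotate; case: (leqP x i) => [-> //|xi] xn; case: (leqP (n + i - x) i); lia. Qed.

End Rotation.

Lemma path_iota_next (r : rel nat) (x m : nat) :
  (forall y, r y y.+1) -> path r x (iota x.+1 m).
Proof. by move=> rS; elim: m x => //= m IHm x; rewrite rS IHm. Qed.

Lemma last_iota_next (x m : nat) : last x (iota x.+1 m) = x + m.
Proof. by elim: m x => [|m IHm] x /=; rewrite ?addn0 // IHm addSnnS. Qed.

Lemma lift_seq_ord (n : nat) (s : seq nat) :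
  (forall k, k \in s -> k < n) -> exists t : seq 'I_n, map val t = s.
Proof.
move=> s_lt; exists (pmap insub s).
rewrite (pmap_filter (insubK _)); apply/all_filterP/allP => k /s_lt.
by rewrite isSome_insub.
Qed.

(** * The cyclic sequence of windows *)

Section RotationWindows.

Variables (n d i : nat).
Hypotheses (d_gt0 : 0 < d) (le_di : d <= i.+1) (lt_in : i + d < n).

(* The starting points of the windows inside [0, i], then the window joining
   the two runs, the windows inside [i + 1, n - 1], and the closing window. *)
Definition rotation_windows : seq nat :=
  iota 0 (i.+1 - d) ++ i :: iota i.+1 (n.-1 - d - i) ++ [:: n.-1].

Lemma mem_rotation_windows (k : nat) :
  (k \in rotation_windows) =
  [|| k + d <= i, k == i, (i < k) && (k + d < n) | k == n.-1].
Proof.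
rewrite mem_cat in_cons mem_cat !mem_iota inE.
by congr [|| _, _, _ | _]; lia.
Qed.

(** Successive starting points differ by 1 inside a run and by [d] where a run ends. A general [r]
    serves both the ordering and the overlaps. *)
Lemma path_rotation_windows (r : rel nat) :
  (forall a b, a < b <= a + d -> r a b) ->
  path r (head 0 rotation_windows) (behead rotation_windows).
Proof.
move=> r_near; have rS y : r y y.+1 by apply: r_near; lia.
have tail_path : path r i (iota i.+1 (n.-1 - d - i) ++ [:: n.-1]).
  rewrite cat_path path_iota_next //= last_iota_next andbT; apply: r_near; lia.
rewrite /rotation_windows; case E : (i.+1 - d) => [|m] //=.
rewrite cat_path path_iota_next //= last_iota_next tail_path andbT.
apply: r_near; lia.
Qed.

Lemma sorted_rotation_windows : sorted ltn rotation_windows.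
Proof.
have := @path_rotation_windows ltn; rewrite /sorted.
by case: rotation_windows => //= x s; apply => a b /andP[].
Qed.

Lemma cycle_rotation_windows :
  cycle (fun a b => [exists t : 'I_d.+1, b == (a + t) %% n]) rotation_windows.
Proof.
have near_mod a b : a <= b <= a + d -> b < n ->
    [exists t : 'I_d.+1, b == (a + t) %% n].
  move=> /andP[ab bad] bn; have ltt : b - a < d.+1 by lia.
  by apply/existsP; exists (Ordinal ltt); rewrite /= subnKC // modn_small.
have windows_lt k : k \in rotation_windows -> k < n.
  rewrite mem_rotation_windows; lia.
(* The head is 0, unless [i.+1 = d]: then the first run is too short for a window and the head is
   [i = d.-1]. *)
have head_le : head 0 rotation_windows <= d.-1.
  rewrite /rotation_windows; case E : (i.+1 - d) => [|m] //=; lia.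
have last_eq : last (head 0 rotation_windows) (behead rotation_windows) = n.-1.
  by rewrite /rotation_windows; case: (iota 0 _) => [|x s] /=;
     rewrite last_cat /= ?last_cat.
have := @path_rotation_windows (fun a b => (a < b <= a + d)) (fun a b => id).
case E : rotation_windows head_le last_eq windows_lt => [|x s] //=.
move=> head_le last_eq windows_lt xs_path; rewrite rcons_path last_eq.
apply/andP; split.
  apply: (sub_in_path (P := [pred k | k < n]) _ _ xs_path); last exact/allP.
  move=> a b _ /= bn /andP[/ltnW ab bad]; apply: near_mod => //.
  by rewrite ab.
(* Back from [n.-1] to the head [x]: the offset [x.+1] passes label 0 and is at most [d]. *)
have xd : x.+1 < d.+1 by lia.
apply/existsP; exists (Ordinal xd) => /=.
have -> : n.-1 + x.+1 = x + n by lia.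
rewrite modnDr modn_small //; lia.
Qed.

End RotationWindows.

Lemma rotation_weakly_hamiltonian (V : finType) (n d : nat) (K : complex V)
    (l : V -> 'I_n) (v w : V) :
  1 <= d -> 2 * d < n -> bijective l -> makes_traceable K d l ->
  val (l w) = (l v).+1 -> d <= l w -> l v < n - d ->
  w |: first_vertices d l \in faces K -> v |: last_vertices d l \in faces K ->
  weakly_hamiltonian K n d.
Proof.
move=> d_gt0 dn l_bij l_tr lw dw vd wK vK.
have [g lK gK] := l_bij.
pose i : nat := l v.
have rot_lt (x : 'I_n) : rotate n i x < n by apply: rotate_lt => //; apply: ltn_ord.
pose rot x := Ordinal (rot_lt x).
have rotK : involutive rot by move=> x; apply: val_inj; rewrite /= rotateK.
pose l' := rot \o l.
have l'_bij : bijective l' by apply: bij_comp => //; apply: inv_bij.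
have valE u : l' u = rotate n i (l u) :> nat by [].
have label_eq (u u' : V) : (u == u') = (val (l u) == val (l u')).
  by rewrite val_eqE (can_eq lK).
have di : d <= i.+1 by rewrite /i -lw.
have idn : i + d < n by rewrite /i; lia.
have [s sE] : exists s : seq 'I_n, map val s = rotation_windows n d i.
  by apply: lift_seq_ord => k; rewrite mem_rotation_windows //; lia.
have mem_s (k : 'I_n) : (k \in s) = ((k : nat) \in rotation_windows n d i).
  by rewrite -sE mem_map //; apply: val_inj.
exists l' => //; exists s; split.
- have := sorted_rotation_windows d_gt0 di idn.
  by rewrite -sE sorted_map.
- move=> k; rewrite mem_s mem_rotation_windows //.
  have := ltn_ord k; move: (k : nat) => {}k kn.
  case/or4P => [kdi|/eqP ki|/andP[ik kdn]|/eqP kn1].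
  (* Labels up to [i] are unchanged. *)
  + have -> : window d l' k = window d l k.
      apply/setP => u; rewrite !in_window ?valE /rotate; last 2 first.
      * lia.
      * lia.
      have := ltn_ord (l u); case: (leqP (l u) i); lia.
    apply: l_tr; rewrite /i in idn kdi *; lia.
  (* New labels [i + 1, .., i + d] are the old [n - 1, .., n - d]. *)
  + have -> : window d l' k = v |: last_vertices d l; last by [].
    apply/setP => u; rewrite in_window ?valE /rotate; last lia.
    rewrite !inE label_eq -/i /=.
    have := ltn_ord (l u); case: (leqP (l u) i); lia.
  (* Reversal maps the interval from [k] to [k + d] onto the one from [n + i - k - d] to
     [n + i - k]. *)
  + have -> : window d l' k = window d l (n + i - k - d).
      apply/setP => u; rewrite !in_window ?valE /rotate; last 2 first.
      * lia.
      * lia.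
      have := ltn_ord (l u); case: (leqP (l u) i); lia.
    apply: l_tr; lia.
  (* New label [n - 1] is the old [i + 1], that of [w]; labels below [d] are fixed since
     [d <= i.+1]. *)
  + have -> : window d l' k = w |: first_vertices d l; last by [].
    apply/setP => u; rewrite kn1 in_last_window ?valE /rotate; last lia.
    rewrite !inE label_eq lw -/i /=.
    have := ltn_ord (l u); case: (leqP (l u) i); lia.
- move=> u; have un := ltn_ord (l' u).
  suff [k /andP[kW uk]] : exists k,
      (k \in rotation_windows n d i) && (u \in window d l' k).
    have kn : k < n by move: kW; rewrite mem_rotation_windows //; lia.
    by exists (Ordinal kn); rewrite ?mem_s.
  have [iu|iu] := leqP (l' u) i.
    have [id|id] := leqP d i.
      exists (minn (l' u) (i - d)); rewrite mem_rotation_windows // in_window; lia.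
    (* Here [i.+1 = d], so the closing window contains the whole first run. *)
    exists n.-1; rewrite mem_rotation_windows // in_last_window; lia.
  have [id|id] := leqP n (i.+1 + d).
    (* Here [n = i + d + 1], so the joining window contains the whole second run. *)
    exists i; rewrite mem_rotation_windows // in_window; lia.
  exists (maxn i.+1 (l' u - d)); rewrite mem_rotation_windows // in_window; lia.
- have := cycle_rotation_windows d_gt0 di idn; rewrite -sE cycle_map.
  apply: sub_cycle => a b; exact: window_meet.
Qed.

Lemma ore_weakly_hamiltonian (V : finType) (n d : nat) (K : complex V)
    (l : V -> 'I_n) :
  1 <= d -> 2 * d < n -> bijective l -> makes_traceable K d l ->
  n <= degree K d (first_vertices d l) + degree K d (last_vertices d l) ->
  weakly_hamiltonian K n d.
Proof.
move=> d_gt0 dn l_bij l_tr le_n.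
have [|v [w [lw dw vd wK vK]]] := rotation_index d_gt0 _ l_bij le_n; first lia.
exact: rotation_weakly_hamiltonian lw dw vd wK vK.
Qed.

(** * Pure complexes and the minimum degree condition *)

(** A face of maximum cardinality is a facet, and purity gives all facets its size. *)
Lemma card_pure_facet (V : finType) (d : nat) (K : complex V) (F : {set V}) :
  has_dim K d -> pure K -> F \in facets K -> #|F| = d.+1.
Proof.
move=> dimK pureK FK.
have K0 : 0 < #|faces K|.
  apply/card_gt0P; move: FK; rewrite inE => /maxsetp FK; by exists F.
have [G GK cardG] := eq_bigmax_cond (fun G : {set V} => #|G|) K0.
rewrite -dimK cardG; apply: pureK => //; rewrite inE; apply/maxsetP.
split=> // H HK GH; apply/eqP; rewrite eq_sym eqEcard GH -cardG.
exact: leq_bigmax_cond.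
Qed.

Lemma facet_degree_le (V : finType) (d : nat) (K : complex V) (rho : {set V}) :
  has_dim K d -> pure K ->
  #|[set F in facets K | rho \subset F]| <= degree K d rho.
Proof.
move=> dimK pureK; apply/subset_leq_card/subsetP => F.
rewrite !inE => /andP[FK ->]; rewrite (maxsetp FK) andbT /=.
by apply/eqP/(card_pure_facet dimK pureK); rewrite inE.
Qed.

Theorem theorem1 (V : finType) (n d : nat) (K : complex V)
  (hd : 1 <= d) (hn : 2 * d < n) (cardV : #|V| = n)
  (dimK : has_dim K d) (trK : traceable K n d) :
  ((exists l : V -> 'I_n,
      [/\ bijective l, makes_traceable K d l &
          n <= degree K d (first_vertices d l)
               + degree K d (last_vertices d l)]) ->
   weakly_hamiltonian K n d)
  /\
  (pure K ->
   (forall rho : {set V}, rho \in faces K -> #|rho| = d ->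
      n <= 2 * #|[set F in facets K | rho \subset F]|) ->
   weakly_hamiltonian K n d).
Proof.
split=> [[l [l_bij l_tr le_n]]|pureK half]; first exact: ore_weakly_hamiltonian le_n.
have [l l_bij l_tr] := trK.
have dn : d <= n by lia.
apply: (@ore_weakly_hamiltonian V n d K l) => //.
(* Any traceable labeling works: [sigma] and [tau] lie in its first and last unwrapped windows,
   hence are faces, and each has degree at least [n / 2]. *)
have firstK : first_vertices d l \in faces K.
  apply: (@face_sub _ K (window d l 0)); first by apply: l_tr; lia.
  apply/subsetP => u; rewrite in_window ?inE; lia.
have lastK : last_vertices d l \in faces K.
  apply: (@face_sub _ K (window d l (n - d.+1))); first by apply: l_tr; lia.
  apply/subsetP => u; rewrite in_window ?inE; have := ltn_ord (l u); lia.
have := half _ firstK (card_first_vertices dn l_bij).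
have := half _ lastK (card_last_vertices dn l_bij).
have := facet_degree_le (first_vertices d l) dimK pureK.
have := facet_degree_le (last_vertices d l) dimK pureK.
lia.
Qed.
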